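(* Let $N$ decision-making units with interval inputs $x_{ij}\in\mathcal{K}_C^{+}$ ($i=1,\dots,M$, $j=1,\dots,N$) and interval outputs $y_{rj}\in\mathcal{K}_C^{+}$ ($r=1,\dots,S$, $j=1,\dots,N$) be given, and let $p\in\{1,\dots,N\}$. Let $(sl^{x^*},su^{x^*},sl^{y^*},su^{y^*},\lambda^*,z^{x^*},z^{y^*})$ be an optimal solution of the model (EIMIL) for $DMU_p$, and let $X_p^{target}=\sum_{j=1}^N\lambda_j^*X_j$ and $Y_p^{target}=\sum_{j=1}^N\lambda_j^*Y_j$. Then $(X_p^{target},Y_p^{target})$ is efficient.
   Context: Intervals: $\mathcal{K}_C=\{[\underline a,\overline a] : \underline a\le\overline a\in\mathbb{R}\}$. For $A=[\underline a,\overline a]$, $B=[\underline b,\overline b]$: $A+B=[\underline a+\underline b,\overline a+\overline b]$; $A-B=[\underline a-\overline b,\overline a-\underline b]$; $A\cdot B=\{ab: a\in A,b\in B\}$ (an interval); $\lambda A=[\lambda\underline a,\lambda\overline a]$ for real $\lambda\ge0$. $A\preceq B$ iff $\underline a\le\underline b$ and $\overline a\le\overline b$; $A\succeq B$ means $B\preceq A$; for vectors of intervals these operations and relations are taken componentwise. Real numbers $c$ are identified with $[c,c]$. $\mathcal{K}_C^{+}=\{A\in\mathcal{K}_C: A\succeq 0\}$. Data: $DMU_j$, $j=1,\dots,N$, has inputs $X_j=(x_{1j},\dots,x_{Mj})\in(\mathcal{K}_C^{+})^M$ and outputs $Y_j=(y_{1j},\dots,y_{Sj})\in(\mathcal{K}_C^{+})^S$,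 with $x_{ij}=[\underline{x_{ij}},\overline{x_{ij}}]$, $y_{rj}=[\underline{y_{rj}},\overline{y_{rj}}]$. The denominators $\underline{x_{ip}}+\overline{x_{ip}}$ and $\underline{y_{rp}}+\overline{y_{rp}}$ in the objective function below are nonzero, so that it is well defined. Production possibility set (variable returns to scale): $$T_{IDEA}=\Big\{(x,y)\in(\mathcal{K}_C^{+})^{M+S} : \exists\,\lambda_1,\dots,\lambda_N\ge0,\ \sum_{j=1}^N\lambda_j=1,\ x\succeq\sum_{j=1}^N\lambda_jX_j,\ y\preceq\sum_{j=1}^N\lambda_jY_j\Big\}.$$ A point $(x_0,y_0)\in T_{IDEA}$ is efficient if and only if for every $(x,y)\in T_{IDEA}$ with $x\preceq x_0$ and $y\succeq y_0$ one has $(x,y)=(x_0,y_0)$. Model (EIMIL) for $DMU_p$: maximize $$\sum_{i=1}^{M}\frac{\underline{sl_i^x}+\underline{su_i^x}+\overline{sl_i^x}+\overline{su_i^x}}{\underline{x_{ip}}+\overline{x_{ip}}}+\sum_{r=1}^{S}\frac{\underline{sl_r^y}+\underline{su_r^y}+\overline{sl_r^y}+\overline{su_r^y}}{\underline{y_{rp}}+\overline{y_{rp}}}$$ over $\lambda_1,\dots,\lambda_N\ge0$ with $\sum_{j=1}^N\lambda_j=1$, intervals $sl_i^x,su_i^x,sl_r^y,su_r^y\in\mathcal{K}_C^{+}$, and binary variables $z_i^x,z_r^y\in\{0,1\}$ subject to, for all $i=1,\dots,M$ and $r=1,\dots,S$: (1) $\sum_{j=1}^N\lambda_j x_{ij}+sl_i^x=x_{ip}-su_i^x$;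 (2) $\sum_{j=1}^N\lambda_j y_{rj}-su_r^y=y_{rp}+sl_r^y$; (3) $sl_i^x\preceq L_i^xz_i^x$, $su_i^x\preceq R_i^x(1-z_i^x)$, $sl_r^y\preceq L_r^yz_r^y$, $su_r^y\preceq R_r^y(1-z_r^y)$. Here $L_i^x,R_i^x,L_r^y,R_r^y$ are fixed positive real constants that are large enough for (3) to be equivalent to the complementarity constraints $sl_i^x\cdot su_i^x=0$, $sl_r^y\cdot su_r^y=0$; that is, whenever $\lambda\ge0$ with $\sum_j\lambda_j=1$ and $sl_i^x,su_i^x,sl_r^y,su_r^y\in\mathcal{K}_C^{+}$ satisfy (1), (2) and these complementarity constraints, one has $sl_i^x\preceq L_i^x$, $su_i^x\preceq R_i^x$, $sl_r^y\preceq L_r^y$, $su_r^y\preceq R_r^y$ for all $i,r$. *)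

(* Defs.v *)
From HB Require Import structures.
From mathcomp Require Import all_boot all_order all_algebra.
From mathcomp Require Import classical_sets set_interval reals.

Set Implicit Arguments.
Unset Strict Implicit.
Unset Printing Implicit Defensive.

Import Order.TTheory GRing.Theory Num.Theory.
Local Open Scope classical_set_scope.
Local Open Scope ring_scope.

Record itvC (R : realType) := ItvC {
  bounds : R * R;
  boundsP : bounds.1 <= bounds.2
}.

HB.instance Definition _ (R : realType) := [isSub for @bounds R].
HB.instance Definition _ (R : realType) := [Choice of itvC R by <:].

Definition lo (R : realType) (A : itvC R) : R := (bounds A).1.
Definition hi (R : realType) (A : itvC R) : R := (bounds A).2.

Section IntervalArithmetic.
Context {R : realType}.
Implicit Types (A B C : itvC R) (a b c : R).

Lemma lo_le_hi A : lo A <= hi A. Proof. exact: boundsP. Qed.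

Lemma itv_eqP A B : lo A = lo B -> hi A = hi B -> A = B.
Proof.
move=> el eh; apply: val_inj => /=.
by rewrite [bounds A]surjective_pairing [bounds B]surjective_pairing; congr pair.
Qed.

Definition itv_pt c : itvC R := @ItvC R (c, c) (lexx c).

Definition itv_add A B : itvC R :=
  @ItvC R (lo A + lo B, hi A + hi B) (lerD (lo_le_hi A) (lo_le_hi B)).

Definition itv_sub A B : itvC R :=
  @ItvC R (lo A - hi B, hi A - lo B) (lerB (lo_le_hi A) (lo_le_hi B)).

Lemma itv_scale_subproof c A :
  Num.min (c * lo A) (c * hi A) <= Num.max (c * lo A) (c * hi A).
Proof. by rewrite ge_min !le_max lexx. Qed.

(* The set [{c * a | a in A}] for any real [c]; see [itv_scale_ge0] for [0 <= c]. *)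
Definition itv_scale c A : itvC R :=
  @ItvC R (Num.min (c * lo A) (c * hi A), Num.max (c * lo A) (c * hi A))
        (itv_scale_subproof c A).

Lemma itv_scale_ge0 c A : 0 <= c ->
  lo (itv_scale c A) = c * lo A /\ hi (itv_scale c A) = c * hi A.
Proof.
move=> c0; have h : c * lo A <= c * hi A by rewrite ler_wpM2l // lo_le_hi.
by split; [apply/min_idPl | apply/max_idPr].
Qed.

Definition itv_set A : set R := [set` `[lo A, hi A]].

(* The product is kept as the set of products of elements; it is only ever
   compared with [itv_set 0], the degenerate interval [0, 0]. *)
Definition itv_mul A B : set R := [set a * b | a in itv_set A & b in itv_set B].

Lemma itv_addA : associative itv_add.
Proof. by move=> A B C; apply: itv_eqP; rewrite /lo /hi /= addrA. Qed.

Lemma itv_addC : commutative itv_add.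
Proof. by move=> A B; apply: itv_eqP; rewrite /lo /hi /= addrC. Qed.

Lemma itv_add0 : left_id (itv_pt 0) itv_add.
Proof. by move=> A; apply: itv_eqP; rewrite /lo /hi /= add0r. Qed.

HB.instance Definition _ := GRing.isNmodule.Build (itvC R) itv_addA itv_addC itv_add0.

Definition itv_le A B : bool := (lo A <= lo B) && (hi A <= hi B).

End IntervalArithmetic.

(* [0 <=C A] expresses that [A] belongs to K_C^+. *)
Notation "A <=C B" := (itv_le A B) (at level 70, no associativity).

Notation itvV R n := {ffun 'I_n -> itvC R}.

Definition leV (R : realType) (n : nat) (u v : itvV R n) : Prop :=
  forall i, u i <=C v i.

Definition scaleV (R : realType) (n : nat) (c : R) (u : itvV R n) : itvV R n :=
  [ffun i => itv_scale c (u i)].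

Definition convex_weights (R : realType) (N : nat) (lam : 'I_N -> R) : Prop :=
  (forall j, 0 <= lam j) /\ \sum_(j < N) lam j = 1.

Section DEA.
Context {R : realType} {M S N : nat}.
Variables (X : 'I_N -> itvV R M) (Y : 'I_N -> itvV R S).

Definition T_IDEA (x : itvV R M) (y : itvV R S) : Prop :=
  [/\ leV 0 x, leV 0 y &
      exists lam : 'I_N -> R,
        [/\ convex_weights lam,
            leV (\sum_(j < N) scaleV (lam j) (X j)) x &
            leV y (\sum_(j < N) scaleV (lam j) (Y j))]].

Definition efficient (x0 : itvV R M) (y0 : itvV R S) : Prop :=
  T_IDEA x0 y0 /\
  forall x y, T_IDEA x y -> leV x x0 -> leV y0 y -> (x, y) = (x0, y0).

Record slacks := Slacks {
  slx : 'I_M -> itvC R;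
  sux : 'I_M -> itvC R;
  sly : 'I_S -> itvC R;
  suy : 'I_S -> itvC R
}.

Record bigM := BigM {
  Lx : 'I_M -> R;
  Rx : 'I_M -> R;
  Ly : 'I_S -> R;
  Ry : 'I_S -> R
}.

Definition slacks_ge0 (s : slacks) : Prop :=
  (forall i, 0 <=C slx s i /\ 0 <=C sux s i) /\
  (forall r, 0 <=C sly s r /\ 0 <=C suy s r).

Variable p : 'I_N.

Definition balance (lam : 'I_N -> R) (s : slacks) : Prop :=
  (forall i, \sum_(j < N) itv_scale (lam j) (X j i) + slx s i
             = itv_sub (X p i) (sux s i)) /\
  (forall r, itv_sub (\sum_(j < N) itv_scale (lam j) (Y j r)) (suy s r)
             = Y p r + sly s r).

Definition complementary (s : slacks) : Prop :=
  (forall i, itv_mul (slx s i) (sux s i) = itv_set 0) /\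
  (forall r, itv_mul (sly s r) (suy s r) = itv_set 0).

Definition bigM_constraints (K : bigM) (s : slacks)
    (zx : 'I_M -> bool) (zy : 'I_S -> bool) : Prop :=
  (forall i, slx s i <=C itv_pt (Lx K i * (zx i)%:R) /\
             sux s i <=C itv_pt (Rx K i * (1 - (zx i)%:R))) /\
  (forall r, sly s r <=C itv_pt (Ly K r * (zy r)%:R) /\
             suy s r <=C itv_pt (Ry K r * (1 - (zy r)%:R))).

Definition bigM_pos (K : bigM) : Prop :=
  (forall i, 0 < Lx K i /\ 0 < Rx K i) /\
  (forall r, 0 < Ly K r /\ 0 < Ry K r).

(* The constants are large enough for [bigM_constraints] (with a suitable choice
   of the binary variables) to be no more restrictive than [complementary]. *)
Definition bigM_large (K : bigM) : Prop :=
  forall (lam : 'I_N -> R) (s : slacks),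
    convex_weights lam -> slacks_ge0 s -> balance lam s -> complementary s ->
    (forall i, slx s i <=C itv_pt (Lx K i) /\ sux s i <=C itv_pt (Rx K i)) /\
    (forall r, sly s r <=C itv_pt (Ly K r) /\ suy s r <=C itv_pt (Ry K r)).

Definition EIMIL_feasible (K : bigM) (lam : 'I_N -> R) (s : slacks)
    (zx : 'I_M -> bool) (zy : 'I_S -> bool) : Prop :=
  [/\ convex_weights lam, slacks_ge0 s, balance lam s &
      bigM_constraints K s zx zy].

Definition EIMIL_objective (s : slacks) : R :=
  \sum_(i < M) (lo (slx s i) + lo (sux s i) + hi (slx s i) + hi (sux s i))
               / (lo (X p i) + hi (X p i)) +
  \sum_(r < S) (lo (sly s r) + lo (suy s r) + hi (sly s r) + hi (suy s r))
               / (lo (Y p r) + hi (Y p r)).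

Definition EIMIL_optimal (K : bigM) (lam : 'I_N -> R) (s : slacks)
    (zx : 'I_M -> bool) (zy : 'I_S -> bool) : Prop :=
  EIMIL_feasible K lam s zx zy /\
  forall lam' s' zx' zy', EIMIL_feasible K lam' s' zx' zy' ->
    EIMIL_objective s' <= EIMIL_objective s.

End DEA.

Arguments slacks : clear implicits.
Arguments bigM : clear implicits.

(* Main.v *)
Require Import Defs.
From mathcomp Require Import all_boot all_order all_algebra.
From mathcomp Require Import classical_sets set_interval reals.
From mathcomp Require Import ring lra.

(** Fix weights [lam] and write tx, ty for the aggregated inputs and outputs.
Both balance equations have the shape [u + A = itv_sub v B], with (u, v) equal to
(tx, X_p) for an input and to (Y_p, ty) for an output.  Endpoint by endpoint such
an equation says that [lo v - lo u = lo A + hi B] and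
[hi v - hi u = hi A + lo B], with two consequences.

- The total of the four slack endpoints is [total v - total u], where
  [total A = lo A + hi A].  Hence the objective depends on the weights alone: it is
  a weighted sum, with positive weights, of the reductions in total input and the
  increases in total output between the unit p and (tx, ty)
  ([objective_balance]).
- Nonnegative slacks solving the equation exist exactly when [u <=C v], and they
  can always be taken complementary, because the two nonnegative gaps
  [lo v - lo u] and [hi v - hi u], once sorted, are the endpoints of an interval
  that can be assigned entirely to A or entirely to B ([gap_split]).  So every
  choice of weights whose aggregate dominates the unit p extends to a feasible
  point of the model ([dominating_feasible]).

If now (x, y) in T_IDEA dominates the optimal target (tx, ty), the weights
witnessing its membership give an aggregate (tx', ty') that dominates (x, y), hence
(tx, ty), hence the unit p.  It is feasible, and its objective exceeds the optimal
one by the weighted gain from (tx, ty) to (tx', ty').  This gain is a sum of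
nonnegative terms and, by optimality, is at most 0; all its terms vanish, so
(tx', ty') = (tx, ty), and (x, y), squeezed in between, is equal to both. *)

Set Implicit Arguments.
Unset Strict Implicit.
Unset Printing Implicit Defensive.

Import Order.TTheory GRing.Theory Num.Theory.
Local Open Scope ring_scope.

(** * The order and the endpoints of intervals *)

Section Endpoints.
Context {R : realType}.
Implicit Types (A B u v : itvC R).

Lemma itv_leP A B : reflect (lo A <= lo B /\ hi A <= hi B) (A <=C B).
Proof. exact: andP. Qed.

Lemma itv_ge0P A : reflect (0 <= lo A /\ 0 <= hi A) (0 <=C A).
Proof. exact: andP. Qed.

Lemma itv_le_refl A : A <=C A.
Proof. by rewrite /itv_le !lexx. Qed.

Lemma itv_le_trans B A C : A <=C B -> B <=C C -> A <=C C.
Proof.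
move=> /itv_leP[l1 h1] /itv_leP[l2 h2].
by apply/itv_leP; split; [apply: le_trans l2 | apply: le_trans h2].
Qed.

Lemma itv_le_anti A B : A <=C B -> B <=C A -> A = B.
Proof.
move=> /itv_leP[l1 h1] /itv_leP[l2 h2].
by apply: itv_eqP; apply: le_anti; apply/andP.
Qed.

Lemma itv_le_add A A' B B' : A <=C A' -> B <=C B' -> A + B <=C A' + B'.
Proof.
by move=> /itv_leP[l1 h1] /itv_leP[l2 h2]; apply/itv_leP; split; apply: lerD.
Qed.

Lemma itv_scale_nneg c A : 0 <= c -> 0 <=C A -> 0 <=C itv_scale c A.
Proof.
move=> c0 /itv_ge0P[lA hA]; have [el eh] := itv_scale_ge0 A c0.
by apply/itv_ge0P; rewrite el eh; split; apply: mulr_ge0.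
Qed.

Lemma itv_sum_nneg (I : Type) (r : seq I) (F : I -> itvC R) :
  (forall i, 0 <=C F i) -> 0 <=C \sum_(i <- r) F i.
Proof.
move=> F0; elim/big_ind: _ => // [|A B A0 B0]; first exact: itv_le_refl.
by rewrite -[0]addr0; apply: itv_le_add.
Qed.

Definition total A : R := lo A + hi A.

Lemma total_le A B : A <=C B -> total A <= total B.
Proof. by move=> /itv_leP[l h]; apply: lerD. Qed.

(** This is how a vanishing gain in [total] becomes an equality of intervals. *)
Lemma itv_le_total_eq A B : A <=C B -> total A = total B -> A = B.
Proof. by rewrite /total => /itv_leP[l h] e; apply: itv_eqP; lra. Qed.

(** * Slack pairs between two intervals *)

Lemma gapP u v A B :
  u + A = itv_sub v B <->
  lo v - lo u = lo A + hi B /\ hi v - hi u = hi A + lo B.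
Proof.
have loE : lo (u + A) = lo u + lo A by [].
have hiE : hi (u + A) = hi u + hi A by [].
have loBE : lo (itv_sub v B) = lo v - hi B by [].
have hiBE : hi (itv_sub v B) = hi v - lo B by [].
split=> [e|[el eh]]; last by apply: itv_eqP; rewrite ?loE ?hiE ?loBE ?hiBE; lra.
have := congr1 (@lo R) e; have := congr1 (@hi R) e; rewrite loE hiE loBE hiBE.
by split; lra.
Qed.

Lemma gap_le u v A B : u + A = itv_sub v B -> 0 <=C A -> 0 <=C B -> u <=C v.
Proof.
move=> /gapP[el eh] /itv_ge0P[lA hA] /itv_ge0P[lB hB].
by apply/itv_leP; split; lra.
Qed.

Lemma gap_total u v A B : u + A = itv_sub v B ->
  lo A + lo B + hi A + hi B = total v - total u.
Proof. by move=> /gapP[el eh]; rewrite /total; lra. Qed.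

Lemma itv_set0 : itv_set (0 : itvC R) = [set 0]%classic.
Proof. exact: set_itv1. Qed.

Lemma itv_mul0l A : itv_mul 0 A = itv_set 0.
Proof.
rewrite /itv_mul itv_set0; apply/seteqP; split=> c /=.
  by move=> [a ->] [b _ <-]; rewrite mul0r.
move=> ->; exists 0 => //; exists (lo A); last by rewrite mul0r.
by rewrite /itv_set /= in_itv /= lexx lo_le_hi.
Qed.

Lemma itv_mul0r A : itv_mul A 0 = itv_set 0.
Proof.
rewrite -[RHS](itv_mul0l A) /itv_mul; apply/seteqP; split=> c /=.
  by move=> [a Aa [b b0 <-]]; exists b => //; exists a => //; rewrite mulrC.
by move=> [b b0 [a Aa <-]]; exists a => //; exists b => //; rewrite mulrC.
Qed.

(** The upper gap [hi v - hi u] minus the lower gap [lo v - lo u] is the width of A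
minus the width of B, so A alone can account for the gaps when the upper one is the
larger, and B alone otherwise.  The boolean records which of the two may be nonzero,
like the binary variables of the model. *)
Lemma gap_split u v : u <=C v -> exists w : itvC R * itvC R * bool,
  [/\ u + w.1.1 = itv_sub v w.1.2, 0 <=C w.1.1, 0 <=C w.1.2 &
      if w.2 then w.1.2 = 0 else w.1.1 = 0].
Proof.
move=> /itv_leP[l h].
case: (leP (lo v - lo u) (hi v - hi u)) => [uv | /ltW vu].
- exists (ItvC (uv : (_, _).1 <= (_, _).2), 0, true); split=> //=.
  + by apply/gapP; rewrite /lo /hi /= !addr0.
  + by apply/itv_ge0P; rewrite /lo /hi /= !subr_ge0.
  + exact: itv_le_refl.
- exists (0, ItvC (vu : (_, _).1 <= (_, _).2), false); split=> //=.
  + by apply/gapP; rewrite /lo /hi /= !add0r.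
  + exact: itv_le_refl.
  + by apply/itv_ge0P; rewrite /lo /hi /= !subr_ge0.
Qed.

Lemma alternative_mul A B (z : bool) :
  (if z then B = 0 else A = 0) -> itv_mul A B = itv_set 0.
Proof. by case: z => ->; [apply: itv_mul0r | apply: itv_mul0l]. Qed.

Lemma alternative_bound A B (z : bool) (a b : R) :
  (if z then B = 0 else A = 0) -> A <=C itv_pt a -> B <=C itv_pt b ->
  A <=C itv_pt (a * z%:R) /\ B <=C itv_pt (b * (1 - z%:R)).
Proof.
by case: z => -> Aa Bb; rewrite ?subrr ?subr0 ?mulr0 ?mulr1; split=> //;
  apply: itv_le_refl.
Qed.

End Endpoints.

(** * Weighted gains between interval vectors *)

Section Gain.
Context {R : realType} {n : nat}.
Implicit Types (u v w : itvV R n).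

Lemma leV_trans v u w : leV u v -> leV v w -> leV u w.
Proof. by move=> uv vw i; apply: itv_le_trans (uv i) (vw i). Qed.

Lemma leV_anti u v : leV u v -> leV v u -> u = v.
Proof. by move=> uv vu; apply/ffunP => i; apply: itv_le_anti. Qed.

Definition aggregate (N : nat) (lam : 'I_N -> R) (Z : 'I_N -> itvV R n) :=
  \sum_(j < N) scaleV (lam j) (Z j).

Lemma aggregateE (N : nat) (lam : 'I_N -> R) (Z : 'I_N -> itvV R n) i :
  aggregate lam Z i = \sum_(j < N) itv_scale (lam j) (Z j i).
Proof. by rewrite sum_ffunE; apply: eq_bigr => j _; rewrite ffunE. Qed.

Lemma aggregate_ge0 (N : nat) (lam : 'I_N -> R) (Z : 'I_N -> itvV R n) :
  convex_weights lam -> (forall j, leV 0 (Z j)) -> leV 0 (aggregate lam Z).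
Proof.
move=> [lam0 _] Z0 i; rewrite aggregateE ffunE.
by apply: itv_sum_nneg => j; apply: itv_scale_nneg => //;
  have := Z0 j i; rewrite ffunE.
Qed.

Definition gain (d : 'I_n -> R) u v : R :=
  \sum_i (total (v i) - total (u i)) / d i.

Lemma gain_chain d v u w : gain d u w = gain d u v + gain d v w.
Proof. by rewrite -big_split; apply: eq_bigr => i _ /=; ring. Qed.

Section PositiveWeights.
Variable d : 'I_n -> R.
Hypothesis d_gt0 : forall i, 0 < d i.

Lemma gain_term_ge0 u v i : leV u v -> 0 <= (total (v i) - total (u i)) / d i.
Proof. by move=> uv; rewrite divr_ge0 ?subr_ge0 ?total_le // ltW. Qed.

Lemma gain_ge0 u v : leV u v -> 0 <= gain d u v.
Proof. by move=> uv; apply: sumr_ge0 => i _; apply: gain_term_ge0. Qed.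

Lemma gain_le0_eq u v : leV u v -> gain d u v <= 0 -> u = v.
Proof.
move=> uv g_le0; have g0 : gain d u v = 0.
  by apply: le_anti; rewrite g_le0 gain_ge0.
apply/ffunP => i; apply: itv_le_total_eq => //; apply/esym/eqP.
have /(_ i isT)/eqP := psumr_eq0P (fun i _ => gain_term_ge0 i uv) g0.
by rewrite mulf_eq0 invr_eq0 (gt_eqF (d_gt0 i)) orbF subr_eq0.
Qed.

End PositiveWeights.

Lemma total_gt0 u : leV 0 u -> (forall i, lo (u i) + hi (u i) != 0) ->
  forall i, 0 < total (u i).
Proof.
move=> u0 u_neq0 i; rewrite lt0r u_neq0 /=.
have /total_le := u0 i; rewrite ffunE; apply: le_trans.
by rewrite /total addr0.
Qed.

(** [gap_split] in every coordinate at once. *)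
Lemma gap_splitV u v : leV u v -> exists A B : 'I_n -> itvC R, exists z,
  forall i, [/\ u i + A i = itv_sub (v i) (B i), 0 <=C A i, 0 <=C B i &
                if z i then B i = 0 else A i = 0].
Proof.
move=> uv; have [w Hw] := fin_all_exists (fun i => gap_split (uv i)).
by exists (fun i => (w i).1.1), (fun i => (w i).1.2), (fun i => (w i).2).
Qed.

End Gain.

(** * The model in terms of weights *)

Section Model.
Context {R : realType} {M S N : nat}.
Variables (X : 'I_N -> itvV R M) (Y : 'I_N -> itvV R S) (p : 'I_N).
Implicit Types (lam : 'I_N -> R) (s : slacks R M S) (K : bigM R M S).

Lemma balanceP lam s : balance X Y p lam s <->
  (forall i, aggregate lam X i + slx s i = itv_sub (X p i) (sux s i)) /\
  (forall r, Y p r + sly s r = itv_sub (aggregate lam Y r) (suy s r)).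
Proof.
split=> -[bx bY]; split=> k; rewrite ?aggregateE.
- exact: bx.
- by rewrite bY.
- by rewrite -aggregateE.
- by rewrite -aggregateE bY.
Qed.

Lemma objective_balance lam s : balance X Y p lam s ->
  EIMIL_objective X Y p s =
  gain (fun i => total (X p i)) (aggregate lam X) (X p) +
  gain (fun r => total (Y p r)) (Y p) (aggregate lam Y).
Proof.
by move=> /balanceP[bx bY]; congr (_ + _); apply: eq_bigr => k _;
  congr (_ / _); apply: gap_total.
Qed.

Lemma feasible_dominating K lam s zx zy :
  EIMIL_feasible X Y p K lam s zx zy ->
  leV (aggregate lam X) (X p) /\ leV (Y p) (aggregate lam Y).
Proof.
move=> [_ [s0x s0y] /balanceP[bx bY] _].
split=> k; first by have [A0 B0] := s0x k; apply: gap_le (bx k) A0 B0.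
by have [A0 B0] := s0y k; apply: gap_le (bY k) A0 B0.
Qed.

(** The slacks of [gap_splitV] are complementary, hence bounded by the constants of
[K], and their booleans serve as the binary variables. *)
Lemma dominating_feasible K lam : bigM_large X Y p K -> convex_weights lam ->
  leV (aggregate lam X) (X p) -> leV (Y p) (aggregate lam Y) ->
  exists s zx zy, EIMIL_feasible X Y p K lam s zx zy.
Proof.
move=> K_large clam /gap_splitV[Ax [Bx [zx Hx]]] /gap_splitV[Ay [By [zy Hy]]].
pose s := Slacks Ax Bx Ay By.
have s0 : slacks_ge0 s by split=> k; [case: (Hx k) | case: (Hy k)].
have bal : balance X Y p lam s.
  by apply/balanceP; split=> k; [case: (Hx k) | case: (Hy k)].
have cs : complementary s.
  by split=> k; [case: (Hx k) | case: (Hy k)] => _ _ _ /alternative_mul.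
have [Kx Ky] := K_large lam s clam s0 bal cs.
exists s, zx, zy; split=> //; split=> k.
  by have [_ _ _ alt] := Hx k; have [] := Kx k; apply: alternative_bound.
by have [_ _ _ alt] := Hy k; have [] := Ky k; apply: alternative_bound.
Qed.

End Model.

Theorem theorem4 (R : realType) (M S N : nat)
  (X : 'I_N -> itvV R M) (Y : 'I_N -> itvV R S) (p : 'I_N)
  (X_ge0 : forall j, leV 0 (X j)) (Y_ge0 : forall j, leV 0 (Y j))
  (Xp_neq0 : forall i, lo (X p i) + hi (X p i) != 0)
  (Yp_neq0 : forall r, lo (Y p r) + hi (Y p r) != 0)
  (K : bigM R M S) (K_pos : bigM_pos K) (K_large : bigM_large X Y p K)
  (lam : 'I_N -> R) (s : slacks R M S) (zx : 'I_M -> bool) (zy : 'I_S -> bool)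
  (opt : EIMIL_optimal X Y p K lam s zx zy) :
  efficient X Y (\sum_(j < N) scaleV (lam j) (X j))
                (\sum_(j < N) scaleV (lam j) (Y j)).
Proof.
have [feas max] := opt; have [clam _ bal _] := feas.
have [tx_le ty_ge] := feasible_dominating feas.
split.
  split; [exact: aggregate_ge0 | exact: aggregate_ge0 |].
  by exists lam; split=> // i; apply: itv_le_refl.
move=> x y [_ _ [lam' [clam' tx'_x y_ty']]] x_tx ty_y.
have tx' := leV_trans tx'_x x_tx; have ty' := leV_trans ty_y y_ty'.
have [s' [zx' [zy' feas']]] := dominating_feasible K_large clam'
  (leV_trans tx' tx_le) (leV_trans ty_ge ty').
have := max _ _ _ _ feas'; case: feas' => _ _ bal' _.
rewrite (objective_balance bal) (objective_balance bal').
have dx_gt0 := total_gt0 (X_ge0 p) Xp_neq0.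
have dy_gt0 := total_gt0 (Y_ge0 p) Yp_neq0.
have gx0 := gain_ge0 dx_gt0 tx'; have gy0 := gain_ge0 dy_gt0 ty'.
rewrite (gain_chain _ (aggregate lam X) _ (X p)).
rewrite (gain_chain _ (aggregate lam Y) (Y p)) => obj_le.
have ex : aggregate lam' X = aggregate lam X.
  by apply: (gain_le0_eq dx_gt0 tx'); rewrite /aggregate in obj_le gx0 gy0 *; lra.
have ey : aggregate lam Y = aggregate lam' Y.
  by apply: (gain_le0_eq dy_gt0 ty'); rewrite /aggregate in obj_le gx0 gy0 *; lra.
congr pair; apply: leV_anti => //.
  by move: tx'_x; rewrite -/(aggregate _ _) ex.
by move: y_ty'; rewrite -/(aggregate _ _) -ey.
Qed.
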